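(* Let $n\ge 1$, let $a_1,\dots,a_{n+1}\in\mathbb R^n$ be affinely independent points, let $S=\operatorname{co}\{a_1,\dots,a_{n+1}\}$, and for $i=1,\dots,n+1$ let $S^i=\operatorname{co}\{a_j: j\neq i\}$. Let $A^1,A^2,\dots,A^{n+1}$ be closed convex subsets of $S$ such that $S^i\subset A^i$ for each $i=1,\dots,n+1$. Then there exist a point $v\in S$ and a number $\varepsilon_0\ge 0$ such that $d(v,A^i)=\varepsilon_0$ for every $i=1,\dots,n+1$. Moreover, if $\varepsilon_0>0$, then $v$ is the unique point of $S$ that is at the same distance from all the sets $A^1,\dots,A^{n+1}$.
   Context: $\operatorname{co}$ denotes the convex hull. $\mathbb R^n$ carries the Euclidean norm $\|\cdot\|$, and $d(u,A)=\inf_{a\in A}\|u-a\|$ is the distance of a point $u$ from a nonempty set $A$. *)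

(* Defs.v *)
From mathcomp Require Import all_boot all_order all_algebra.
From mathcomp Require Import all_classical all_reals all_analysis.
Set Implicit Arguments.
Unset Strict Implicit.
Unset Printing Implicit Defensive.
Import Order.TTheory GRing.Theory Num.Theory.
Import numFieldNormedType.Exports.
Local Open Scope classical_set_scope.
Local Open Scope ring_scope.

(* The norm [`|x|] that the library puts on row vectors is the sup norm.  Both
   norms induce the same topology, so the library's [closed] is closedness in
   the Euclidean sense. *)
Definition enorm (R : realType) (n : nat) (x : 'rV[R]_n) : R :=
  Num.sqrt (\sum_(i < n) x 0 i ^+ 2).

(* [inf] is only meaningful here for nonempty [A]. *)
Definition dist_set (R : realType) (n : nat) (u : 'rV[R]_n) (A : set 'rV[R]_n) : R :=
  inf [set enorm (u - a) | a in A].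

Definition convex_hull (R : realType) (n : nat) (A : set 'rV[R]_n) :
    set 'rV[R]_n :=
  smallest (@convex_set R 'rV[R]_n) A.

Definition affinely_independent (R : realType) (n m : nat)
    (a : 'I_m -> 'rV[R]_n) : Prop :=
  forall c : 'I_m -> R,
    \sum_(j < m) c j = 0 -> \sum_(j < m) c j *: a j = 0 -> forall j, c j = 0.

Definition simplex (R : realType) (n m : nat) (a : 'I_m -> 'rV[R]_n) :
    set 'rV[R]_n :=
  convex_hull (range a).

Definition facet (R : realType) (n m : nat) (a : 'I_m -> 'rV[R]_n) (i : 'I_m) :
    set 'rV[R]_n :=
  convex_hull [set a j | j in [set j | j != i]].

(* Main.v *)
(* Existence: minimise F := max_i d(., A^i) over the compact set S.  At a minimum
   point v no d(v, A^k) can be smaller than F(v): the vertex a_k lies in A^j for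
   every j <> k, so by convexity a small move from v towards a_k strictly lowers
   every d(., A^j) with j <> k and keeps d(., A^k) below F(v).
   Uniqueness: let v <> w in S be equidistant, with distances d > 0 and e.  The
   ray from w through v leaves S at a point y of some facet S^i, where
   d(y, A^i) = 0; convexity on the segment [w, y] gives d < e.  Then e > 0, and
   by symmetry e < d, a contradiction. *)
Require Import Defs.
From mathcomp Require Import all_boot all_order all_algebra.
From mathcomp Require Import all_classical all_reals all_analysis.
From mathcomp Require Import lra ring.
Set Implicit Arguments.
Unset Strict Implicit.
Unset Printing Implicit Defensive.
Import Order.TTheory GRing.Theory Num.Theory.
Import numFieldNormedType.Exports.
Local Open Scope classical_set_scope.
Local Open Scope ring_scope.

(** * Convex combinations and barycentric coordinates *)

Lemma convex_setP (R : realType) (n : nat) (C : set 'rV[R]_n) :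
  @convex_set R 'rV[R]_n C <->
  forall x y t, 0 <= t -> t <= 1 -> C x -> C y -> C (t *: x + (1 - t) *: y).
Proof.
split=> [cC x y t t0 t1 Cx Cy|cC x y l /set_mem Cx /set_mem Cy].
  by have /set_mem := cC x y (Itv01 t0 t1) (mem_set Cx) (mem_set Cy).
by apply/mem_set; exact: cC.
Qed.

(** Induction on the number of points: the last term is split off and the others are rescaled by
    their total weight [s]. Membership is asked only where the weight is nonzero, so that points of
    a facet can be written with all the vertices. *)
Lemma convex_sum (R : realType) (n m : nat) (C : set 'rV[R]_n)
    (x : 'I_m -> 'rV[R]_n) (c : 'I_m -> R) :
  @convex_set R 'rV[R]_n C -> (forall j, 0 <= c j) -> \sum_j c j = 1 ->
  (forall j, c j != 0 -> C (x j)) -> C (\sum_j c j *: x j).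
Proof.
move=> /convex_setP cC; elim: m => [|m IHm] in x c * => c0.
  by rewrite big_ord0 => /eqP; rewrite eq_sym oner_eq0.
rewrite !big_ord_recr /=; set t := c ord_max; set s := \sum_(i < m) _ => st1 Cx.
have s0 : 0 <= s by apply: sumr_ge0.
have [s_eq0|s_neq0] := eqVneq s 0.
  rewrite big1 => [|i _]; last first.
    by rewrite (psumr_eq0P _ s_eq0) ?scale0r.
  rewrite add0r (_ : t = 1) ?scale1r; last by rewrite -st1 s_eq0 add0r.
  by apply: Cx; rewrite -/t; move: st1; rewrite s_eq0 add0r => ->; rewrite oner_eq0.
pose w i := widen_ord (leqnSn m) i.
have Cs : C (\sum_(i < m) (s^-1 * c (w i)) *: x (w i)).
  apply: IHm => [j||j]; first by rewrite mulr_ge0 ?invr_ge0.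
    by rewrite -mulr_sumr mulVf.
  by rewrite mulf_eq0 negb_or => /andP[_]; apply: Cx.
have sE : \sum_(i < m) c (w i) *: x (w i) =
    s *: \sum_(i < m) (s^-1 * c (w i)) *: x (w i).
  by rewrite scaler_sumr; apply: eq_bigr => i _; rewrite scalerA mulVKf.
(* The case [t = 0] is separate because the last point may then lie outside [C]. *)
rewrite sE; have [t0|t_neq0] := eqVneq t 0.
  by rewrite t0 scale0r addr0 (_ : s = 1) ?scale1r //; rewrite -st1 t0 addr0.
have -> : t = 1 - s by rewrite -st1 addrAC subrr add0r.
apply: cC => //; last exact: Cx.
by rewrite -st1 lerDl c0.
Qed.

Definition std_simplex (R : realType) (m : nat) : set 'rV[R]_m :=
  [set l | (forall j, 0 <= l 0 j) /\ \sum_j l 0 j = 1].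

Definition bary (R : realType) (n m : nat) (a : 'I_m -> 'rV[R]_n)
  (l : 'rV[R]_m) : 'rV[R]_n := \sum_j l 0 j *: a j.

Lemma bary_lin (R : realType) (n m : nat) (a : 'I_m -> 'rV[R]_n) (s t : R) l k :
  bary a (s *: l + t *: k) = s *: bary a l + t *: bary a k.
Proof.
rewrite /bary !scaler_sumr -big_split /=; apply: eq_bigr => j _.
by rewrite !mxE scalerDl !scalerA.
Qed.

Lemma bary_delta (R : realType) (n m : nat) (a : 'I_m -> 'rV[R]_n) i :
  bary a (delta_mx 0 i) = a i.
Proof.
rewrite /bary (bigD1 i) //= mxE !eqxx scale1r big1 ?addr0 // => j ji.
by rewrite mxE (negPf ji) andbF scale0r.
Qed.

Lemma std_simplex_delta (R : realType) (m : nat) (i : 'I_m) :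
  std_simplex (delta_mx 0 i : 'rV[R]_m).
Proof.
split=> [j|]; first by rewrite mxE.
rewrite (bigD1 i) //= mxE !eqxx big1 ?addr0 // => j ji.
by rewrite mxE (negPf ji) andbF.
Qed.

(** The image is convex because [bary a] preserves convex combinations, and it contains the vertices
    as images of the unit vectors. This gives both compactness of the simplex and coordinates in
    which to find its facets. *)
Lemma simplexE (R : realType) (n m : nat) (a : 'I_m -> 'rV[R]_n) :
  simplex a = bary a @` @std_simplex R m.
Proof.
apply/seteqP; split.
  apply: smallest_sub.
    apply/convex_setP => _ _ t t0 t1 [l [l0 l1] <-] [k [k0 k1] <-].
    exists (t *: l + (1 - t) *: k); last exact: bary_lin.
    split=> [j|]; first by rewrite !mxE addr_ge0 ?mulr_ge0 ?subr_ge0.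
    under eq_bigr do rewrite !mxE.
    by rewrite big_split /= -!mulr_sumr l1 k1 !mulr1 addrC subrK.
  move=> _ [i _ <-]; exists (delta_mx 0 i); last exact: bary_delta.
  exact: std_simplex_delta.
move=> _ [l [l0 l1] <-] C [cC aC]; apply: convex_sum => // j _.
by apply: aC; exists j.
Qed.

Lemma facet_bary (R : realType) (n m : nat) (a : 'I_m -> 'rV[R]_n) i l :
  std_simplex l -> l 0 i = 0 -> facet a i (bary a l).
Proof.
move=> [l0 l1] li C [cC aC]; apply: convex_sum => // j.
by move=> lj; apply: aC; exists j => //=; apply: contraNneq lj => ->; rewrite li.
Qed.

Lemma facet_vertex (R : realType) (n m : nat) (a : 'I_m -> 'rV[R]_n) i j :
  j != i -> facet a i (a j).
Proof. by move=> ji; apply: sub_gen_smallest; exists j. Qed.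

(** A closed subset of the compact cube of vectors with all coordinates in [0, 1]. *)
Lemma compact_std_simplex (R : realType) (m : nat) : compact (@std_simplex R m).
Proof.
apply: (@subclosed_compact _ _
  [set v : 'rV[R]_m | forall i, `[0, 1]%classic (v ord0 i)]).
- rewrite (_ : @std_simplex R m = (\bigcap_i [set l | 0 <= l 0 i]) `&`
    [set l | \sum_j l 0 j = 1]); last first.
    apply/seteqP; split=> l [l0 l1]; split=> // j; last exact: l0.
    by move=> _; exact: l0.
  apply: closedI.
    apply: closed_bigI => i _.
    apply: (@preimage_closed _ _ (fun l : 'rV[R]_m => l 0 i) [set x | 0 <= x]).
      by move=> l _; exact: coord_continuous.
    exact: closed_ge.
  apply: (@preimage_closed _ _ (fun l : 'rV[R]_m => \sum_j l 0 j) [set x | x = 1]).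
    move=> l _; move: l; apply: continuous_big => [|i _].
      exact: add_continuous.
    exact: coord_continuous.
  exact: closed_eq.
- by apply: (@rV_compact R m (fun=> `[0, 1]%classic)) => i; exact: segment_compact.
- move=> l [l0 l1] i /=; rewrite in_itv /= l0 /= -l1 (bigD1 i) //= lerDl.
  exact: sumr_ge0.
Qed.

Lemma compact_simplex (R : realType) (n m : nat) (a : 'I_m -> 'rV[R]_n) :
  compact (simplex a).
Proof.
rewrite simplexE; apply: continuous_compact; last exact: compact_std_simplex.
apply: continuous_subspaceT; apply: continuous_big => [|i _ l].
  exact: add_continuous.
by apply: (@cvgZr_tmp _ _ _ (nbhs l)); exact: coord_continuous.
Qed.

(** * The Euclidean norm *)

Lemma enorm_ge0 (R : realType) (n : nat) (x : 'rV[R]_n) : 0 <= enorm x.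
Proof. exact: sqrtr_ge0. Qed.

Lemma sqr_enorm (R : realType) (n : nat) (x : 'rV[R]_n) :
  enorm x ^+ 2 = \sum_i x 0 i ^+ 2.
Proof. by rewrite sqr_sqrtr // sumr_ge0 // => i _; rewrite sqr_ge0. Qed.

Lemma enormZ (R : realType) (n : nat) (t : R) (x : 'rV[R]_n) :
  enorm (t *: x) = `|t| * enorm x.
Proof.
rewrite /enorm -sqrtr_sqr -sqrtrM ?sqr_ge0 // mulr_sumr.
by congr Num.sqrt; apply: eq_bigr => i _; rewrite mxE exprMn.
Qed.

Lemma enorm_eq0 (R : realType) (n : nat) (x : 'rV[R]_n) : enorm x = 0 -> x = 0.
Proof.
move=> x0; apply/rowP => i; rewrite mxE; apply/eqP; rewrite -sqrf_eq0; apply/eqP.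
have := sqr_enorm x; rewrite x0 expr0n => /esym /psumr_eq0P; apply=> // j _.
exact: sqr_ge0.
Qed.

Lemma enorm0 (R : realType) (n : nat) : enorm (0 : 'rV[R]_n) = 0.
Proof. by rewrite -(scale0r 0) enormZ normr0 mul0r. Qed.

Lemma enorm_cauchy_schwarz (R : realType) (n : nat) (x y : 'rV[R]_n) :
  \sum_i x 0 i * y 0 i <= enorm x * enorm y.
Proof.
have [/enorm_eq0 ->|x0] := eqVneq (enorm x) 0.
  by rewrite big1 ?mulr_ge0 ?enorm_ge0 // => i _; rewrite mxE mul0r.
have [/enorm_eq0 ->|y0] := eqVneq (enorm y) 0.
  by rewrite big1 ?mulr_ge0 ?enorm_ge0 // => i _; rewrite mxE mulr0.
have xy0 : 0 < enorm x * enorm y by rewrite mulr_gt0 // lt0r ?x0 ?y0 enorm_ge0.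
(* With p = [enorm x * enorm y], this sum of squares expands to 2p(p - <x, y>), and p > 0 can be
   cancelled. *)
have : 0 <= \sum_i (enorm y * x 0 i - enorm x * y 0 i) ^+ 2.
  by apply: sumr_ge0 => i _; rewrite sqr_ge0.
rewrite (_ : \sum_i _ = 2 * (enorm x * enorm y) *
    (enorm x * enorm y - \sum_i x 0 i * y 0 i)).
  by rewrite pmulr_rge0 ?subr_ge0 // mulr_gt0.
rewrite (eq_bigr (fun i => enorm y ^+ 2 * x 0 i ^+ 2 + enorm x ^+ 2 * y 0 i ^+ 2
    - 2 * (enorm x * enorm y) * (x 0 i * y 0 i))); last by move=> i _; ring.
by rewrite sumrB big_split /= -!mulr_sumr -!sqr_enorm; ring.
Qed.

Lemma ler_enormD (R : realType) (n : nat) (x y : 'rV[R]_n) :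
  enorm (x + y) <= enorm x + enorm y.
Proof.
rewrite -(@ler_pXn2r _ 2) ?nnegrE ?addr_ge0 ?enorm_ge0 //.
rewrite sqrrD !sqr_enorm (eq_bigr (fun i => x 0 i ^+ 2 + (x 0 i * y 0 i) *+ 2
    + y 0 i ^+ 2)) => [|i _]; last by rewrite mxE sqrrD.
by rewrite !big_split /= -mulr2n lerD2r lerD2l lerMn2r enorm_cauchy_schwarz.
Qed.

(** Lets Euclidean estimates yield continuity for the library topology, which comes from the sup
    norm. *)
Lemma enorm_le_sup (R : realType) (n : nat) (x : 'rV[R]_n) :
  enorm x <= Num.sqrt n%:R * `|x|.
Proof.
rewrite -[`|x|]ger0_norm // -sqrtr_sqr -sqrtrM ?ler0n //.
rewrite ler_wsqrtr // mulr_natl -[X in _ *+ X]card_ord -sumr_const ler_sum // => i _.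
rewrite -real_normK ?num_real // ler_pXn2r ?nnegrE //.
rewrite [leRHS]mx_normrE (le_trans _ (le_bigmax _ _ (0, i))) //.
Qed.

(** * The distance to a set *)

Section DistSet.
Context (R : realType) (n : nat) (A : set 'rV[R]_n).

Let image_lbound (u : 'rV[R]_n) : lbound [set enorm (u - a) | a in A] 0.
Proof. by move=> _ [a _ <-]; exact: enorm_ge0. Qed.

Lemma dist_set_le u a : A a -> dist_set u A <= enorm (u - a).
Proof. by move=> Aa; apply: ge_inf; [exists 0; exact: image_lbound|exists a]. Qed.

Hypothesis A0 : A !=set0.

Let image_nonempty (u : 'rV[R]_n) : [set enorm (u - a) | a in A] !=set0.
Proof. by have [a Aa] := A0; exists (enorm (u - a)), a. Qed.

Lemma dist_set_ge0 u : 0 <= dist_set u A.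
Proof. exact: lb_le_inf. Qed.

Lemma dist_set_eq0 u : A u -> dist_set u A = 0.
Proof.
move=> Au; apply: le_anti; rewrite dist_set_ge0 andbT.
by have := dist_set_le u Au; rewrite subrr enorm0.
Qed.

Lemma dist_set_adherent u e : 0 < e ->
  exists2 a, A a & enorm (u - a) < dist_set u A + e.
Proof.
move=> e0; have [|_ [a Aa <-] lta] := @inf_adherent _ [set enorm (u - a) | a in A] _ e0.
  by split=> //; exists 0.
by exists a.
Qed.

Lemma dist_set_lip u v : dist_set u A <= dist_set v A + enorm (u - v).
Proof.
apply/ler_addgt0Pr => e /(dist_set_adherent v)[a Aa lta].
apply: le_trans (dist_set_le u Aa) _.
rewrite -(subrK v u) -addrA; apply: le_trans (ler_enormD _ _) _.
by rewrite subrK; lra.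
Qed.

(** If [a] and [b] in [A] nearly realise the distances from [u] and [v], then
    [t *: a + (1 - t) *: b] is in [A] and serves as a competitor for the combined point. *)
Lemma dist_set_convex u v t :
  @convex_set R 'rV[R]_n A -> 0 <= t -> t <= 1 ->
  dist_set (t *: u + (1 - t) *: v) A <=
  t * dist_set u A + (1 - t) * dist_set v A.
Proof.
move=> /convex_setP cA t0 t1; apply/ler_addgt0Pr => e e0.
have [a Aa lta] := dist_set_adherent u e0.
have [b Ab ltb] := dist_set_adherent v e0.
apply: le_trans (dist_set_le _ (cA a b t t0 t1 Aa Ab)) _.
rewrite opprD addrACA -!scalerBr; apply: le_trans (ler_enormD _ _) _.
rewrite !enormZ !ger0_norm ?subr_ge0 //; nra.
Qed.

End DistSet.

(** A maximum of functions with a common Lipschitz constant has that constant too. The base value 0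
    of the maximum is harmless, since distances are nonnegative. *)
Lemma dist_set_max_continuous (R : realType) (n m : nat)
    (A : 'I_m -> set 'rV[R]_n) : (forall i, A i !=set0) ->
  continuous (fun x : 'rV[R]_n => \big[Num.max/0]_i dist_set x (A i)).
Proof.
(* The added 1 keeps [k] positive even for [n = 0], so that dividing by it is legitimate. *)
move=> A0; set F := fun x => _; set k := Num.sqrt n%:R + 1 : R.
have k0 : 0 < k by rewrite ltr_wpDl ?sqrtr_ge0.
have F_lip x y : F x - F y <= k * `|x - y|.
  rewrite lerBlDl; apply: bigmax_le => [|i _].
    apply: addr_ge0; last by rewrite mulr_ge0 // ltW.
    exact: bigmax_ge_id.
  apply: le_trans (dist_set_lip (A0 i) x y) _.
  apply: lerD; first exact: le_bigmax.
  by apply: le_trans (enorm_le_sup _) _; rewrite ler_wpM2r // lerDl.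
move=> x; apply/(@cvgrPdist_le _ _ _ (nbhs x)) => e e0; near=> y.
have : k * `|x - y| <= e.
  rewrite -ler_pdivlMl //; near: y.
  apply: (@cvgr_dist_le _ _ _ (nbhs x) _ id x (@cvg_id _ (nbhs x))).
  by rewrite mulr_gt0 ?invr_gt0.
by apply: le_trans; rewrite ler_norml lerNl opprB F_lip distrC F_lip.
Unshelve. all: by end_near. Qed.

(* The line from [l] through [k] leaves the standard simplex at [y]; [s] is the
   ratio of the distances from [k] to [y] and from [l] to [k]. *)
Lemma std_simplex_face (R : realType) (m : nat) (k l : 'rV[R]_m) :
  std_simplex k -> std_simplex l -> k != l ->
  exists i s y, [/\ 0 <= s, std_simplex y, y 0 i = 0 &
    k = (1 + s)^-1 *: (y + s *: l)].
Proof.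
move=> [k0 k1] [l0 l1] kl.
(* Otherwise every [k 0 i - l 0 i] is nonnegative; these differences sum to 0, so all vanish and
   [k = l]. *)
have [i0 ki0] : exists i, k 0 i < l 0 i.
  apply/existsP; apply: contraNT kl; rewrite negb_exists => /forallP lk.
  apply/eqP/rowP => i; apply/eqP; rewrite -subr_eq0; apply/eqP.
  move: i; have /psumr_eq0P : \sum_i (k 0 i - l 0 i) = 0.
    by rewrite sumrB k1 l1 subrr.
  move=> H i; apply: H => // j _; by rewrite subr_ge0 leNgt.
(* [q i] is the value of s at which coordinate [i] of [k + s *: (k - l)] vanishes; the smallest one
   marks the exit point. *)
pose q i := k 0 i / (l 0 i - k 0 i).
have [i ki qi] := @arg_minP _ _ _ i0 (fun i => k 0 i < l 0 i) q ki0.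
have s0 : 0 <= q i by rewrite divr_ge0 // subr_ge0 ltW.
have s1 : 1 + q i != 0 by rewrite gt_eqF // ltr_wpDr.
exists i, (q i), (k + q i *: (k - l)); split=> //.
- split=> [j|].
    (* A coordinate decreases beyond [k] only if [k 0 j < l 0 j], and then [q i <= q j] keeps it
       nonnegative. *)
    rewrite !mxE; have [lk|kj] := leP (l 0 j) (k 0 j).
      by rewrite addr_ge0 // mulr_ge0 // subr_ge0.
    by have := qi j kj; rewrite {2}/q ler_pdivlMr ?subr_gt0 //; lra.
  under eq_bigr do rewrite !mxE.
  by rewrite big_split /= -mulr_sumr sumrB k1 l1 subrr mulr0 addr0.
- by rewrite !mxE /q; field; rewrite subr_eq0 gt_eqF.
- by apply/rowP => j; rewrite !mxE; field.
Qed.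

(** * Existence and comparison of equidistant points *)

Section Equidistant.
Context (R : realType) (n m : nat) (a : 'I_m -> 'rV[R]_n).
Context (A : 'I_m -> set 'rV[R]_n).
Hypothesis A_convex : forall i, @convex_set R 'rV[R]_n (A i).
Hypothesis facet_sub : forall i, facet a i `<=` A i.
Hypothesis A_nonempty : forall i, A i !=set0.

Lemma equidistant_exists (i0 : 'I_m) : exists v, simplex a v /\
  forall i, dist_set v (A i) = \big[Num.max/0]_j dist_set v (A j).
Proof.
set F := fun x : 'rV[R]_n => \big[Num.max/0]_j dist_set x (A j).
have vertexS i : simplex a (a i) by apply: sub_gen_smallest; exists i.
have [//||v /set_mem Sv v_min] := @EVT_min_rV _ _ F _ _ (@compact_simplex _ _ _ a).
- by exists (a i0).
- by apply: continuous_subspaceT; exact: dist_set_max_continuous.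
exists v; split=> // k; apply: le_anti; rewrite le_bigmax /= leNgt.
apply/negP => lt_k; rewrite -/(F v) in lt_k.
set f := dist_set v (A k) in lt_k; set M := dist_set (a k) (A k).
have f0 : 0 <= f by exact: dist_set_ge0.
have M0 : 0 <= M by exact: dist_set_ge0.
(* Chosen so that t * M < F v - f. *)
pose t := (F v - f) / (F v - f + M + 1).
have tE : t * (F v - f + M + 1) = F v - f by rewrite divfK //; lra.
have t0 : 0 < t by rewrite divr_gt0; lra.
have t1 : t <= 1 by rewrite ler_pdivrMr; lra.
pose x := t *: a k + (1 - t) *: v.
have Sx : simplex a x.
  move=> C [cC aC]; move/convex_setP: (cC); apply=> //; first exact: ltW.
    exact: vertexS.
  exact: Sv.
have := v_min x (mem_set Sx); rewrite leNgt => /negP; apply.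
apply: bigmax_lt => [|j _]; first exact: le_lt_trans f0 lt_k.
have := dist_set_convex (A_nonempty j) (a k) v (@A_convex j) (ltW t0) t1.
move/le_lt_trans; apply.
(* For [j = k] the bound is t M + (1 - t) f <= t M + f < F v, by the choice of [t]. *)
have [->|jk] := eqVneq j k; first by rewrite -/f -/M; nra.
have /facet_sub/(dist_set_eq0 (A_nonempty j)) -> : facet a j (a k).
  by apply: facet_vertex; rewrite eq_sym.
(* For [j != k] the bound is (1 - t) F v, which is less than F v because F v > f >= 0. *)
have : dist_set v (A j) <= F v by exact: le_bigmax.
by rewrite mulr0 add0r; nra.
Qed.

Lemma equidistant_lt v w d e : simplex a v -> simplex a w -> v != w ->
  (forall i, dist_set v (A i) = d) -> (forall i, dist_set w (A i) = e) ->
  0 < d -> d < e.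
Proof.
rewrite simplexE => -[k Sk <-] [l Sl <-] kl dv dw d0.
have {}kl : k != l by apply: contraNneq kl => ->.
have [i [s [y [s0 Sy yi kE]]]] := std_simplex_face Sk Sl kl.
have s1 : 0 < 1 + s by lra.
have dy : dist_set (bary a y) (A i) = 0.
  apply: (dist_set_eq0 (A_nonempty i)); apply: facet_sub; exact: facet_bary.
have t0 : 0 <= (1 + s)^-1 by rewrite invr_ge0 ltW.
have t1 : (1 + s)^-1 <= 1 by rewrite invf_le1 // lerDl.
have := dist_set_convex (A_nonempty i) (bary a y) (bary a l) (@A_convex i) t0 t1.
rewrite -bary_lin (_ : _ + _ = k); last first.
  rewrite kE; apply/rowP => j; rewrite !mxE; field; exact: lt0r_neq0.
rewrite dv dw dy mulr0 add0r => de.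
(* From d <= (1 - (1 + s)^-1) e with d > 0 and a nonnegative factor, e is positive; the factor is
   below 1, so d < e. *)
have : (1 + s)^-1 > 0 by rewrite invr_gt0.
nra.
Qed.

End Equidistant.

Theorem theorem1 (R : realType) (n : nat) (n_gt0 : (0 < n)%N)
    (a : 'I_n.+1 -> 'rV[R]_n) (a_indep : affinely_independent a)
    (A : 'I_n.+1 -> set 'rV[R]_n)
    (A_closed : forall i, closed (A i))
    (A_convex : forall i, @convex_set R 'rV[R]_n (A i))
    (A_sub : forall i, A i `<=` simplex a)
    (facet_sub : forall i, facet a i `<=` A i) :
  (exists (v : 'rV[R]_n) (eps0 : R),
     [/\ simplex a v, 0 <= eps0 & forall i, dist_set v (A i) = eps0]) /\
  (forall (v : 'rV[R]_n) (eps0 : R),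
     simplex a v -> (forall i, dist_set v (A i) = eps0) -> 0 < eps0 ->
     forall w : 'rV[R]_n, simplex a w ->
       (forall i j, dist_set w (A i) = dist_set w (A j)) -> w = v).
Proof.
have A_nonempty i : A i !=set0.
  (* A vertex of the facet opposite [a i] is a point of [A i]; a second index exists because
     [0 < n]. *)
  suff [j ji] : exists j, j != i by exists (a j); apply: facet_sub; exact: facet_vertex.
  have [->|i0] := eqVneq i ord0; last by exists ord0; rewrite eq_sym.
  by exists ord_max; rewrite -val_eqE /= -lt0n.
split.
  have [v [Sv dv]] := equidistant_exists A_convex facet_sub A_nonempty ord0.
  exists v, (\big[Num.max/0]_j dist_set v (A j)); split=> //; exact: bigmax_ge_id.
move=> v d Sv dv d0 w Sw dw; apply/eqP; rewrite eq_sym; apply: contraT => vw.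
(* The distance from [w] to [A ord0] serves as the common value e. *)
have dw0 i : dist_set w (A i) = dist_set w (A ord0) by [].
have lt := equidistant_lt A_convex facet_sub A_nonempty.
have de := lt _ _ _ _ Sv Sw vw dv dw0 d0.
have := lt _ _ _ _ Sw Sv _ dw0 dv (lt_trans d0 de).
by rewrite eq_sym => /(_ vw); rewrite ltNge (ltW de).
Qed.
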